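(* A realiser for $\mathrm{MCT}^0_{\mathrm{net}}$ computes $\exists^3$ via a term of G\''odel's $T$, and vice versa. That is, there is a term $t$ of G\''odel's $T$ such that for every realiser $\Phi$ for $\mathrm{MCT}^0_{\mathrm{net}}$, $t(\Phi)$ is the functional $\exists^3$; and there is a term $s$ of G\''odel's $T$ such that $s(\exists^3)$ is a realiser for $\mathrm{MCT}^0_{\mathrm{net}}$.
   Context: Finite types: $0$ is the type of natural numbers, $\sigma\to\tau$ the type of mappings from type $\sigma$ to type $\tau$ objects, $1:=0\to0$, $n+1:=n\to0$; superscripts denote types. G\''odel's $T$ is the system of (higher-order) primitive recursive functionals of finite type: its terms are the closed terms built from zero, successor, the combinators ($\lambda$-abstraction) and primitive recursors of all finite types. The functional $\exists^3$ is $E^3\le_31$ such that for all $Y^2$: $(\exists f^1)(Y(f)=0)\leftrightarrow E(Y)=0$. Reals are represented by type 1 objects, namely sequences of rationals $(q_n)$ with $|q_n-q_{n+i}|<2^{-n}$ for all $n,i$; equality of reals is $|q_n-r_n|\le2^{-n+1}$ for all $n$. A subset $D$ of Baire space $\mathbb{N}^{\mathbb{N}}$ is given by its characteristic function of type $2$, and a binary relation $\preceq$ on $D$ by its characteristic function of type $(1\times1)\to0$. $(D,\preceq)$ with $D\ne\emptyset$ is directed if $\preceq$ is transitive and reflexive on $D$ and any two elements $x,y$ of $D$ have some $z\in D$ with $x\preceq z$, $y\preceq z$. A net in $[0,1]$ is a map $x_d:D\to[0,1]$ with $(D,\preceq)$ directed; it is increasing if $a\preceq b$ implies $x_a\le x_b$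 for $a,b\in D$; it converges to $x$, written $\lim_dx_d=x$, if $(\forall\varepsilon>0)(\exists d_0\in D)(\forall e\succeq d_0)(|x_e-x|<\varepsilon)$. $\mathrm{MCT}^0_{\mathrm{net}}$ is the statement that every increasing net in $[0,1]$ indexed by a subset of Baire space converges. A realiser for $\mathrm{MCT}^0_{\mathrm{net}}$ is a functional taking as input $(D,\preceq_D,x_d)$ and outputting the real $x=\lim_dx_d$ whenever the inputs satisfy the conditions of $\mathrm{MCT}^0_{\mathrm{net}}$ (i.e. $D$ is a subset of Baire space, $(D,\preceq_D)$ is directed and $x_d:D\to[0,1]$ is an increasing net). *)

(* Defs.v *)
From Stdlib Require Import Reals Lra Lia List QArith Qabs Qreals Qpower Cantor.
From Stdlib Require Import FunctionalExtensionality ClassicalEpsilon.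
From Coquelicot Require Import Coquelicot.
Import ListNotations.

Set Implicit Arguments.

Inductive ty : Set :=
| Nat : ty
| Arr : ty -> ty -> ty.

Declare Scope ty_scope.
Delimit Scope ty_scope with ty.
Bind Scope ty_scope with ty.
Notation "s ~> t" := (Arr s t) (at level 55, right associativity) : ty_scope.

Fixpoint pure (n : nat) : ty :=
  match n with
  | O => Nat
  | S m => pure m ~> Nat
  end.

(** Full set-theoretic type structure. *)
Fixpoint obj (s : ty) : Set :=
  match s with
  | Nat => nat
  | Arr s t => obj s -> obj t
  end.

Inductive var : list ty -> ty -> Set :=
| VZ : forall G s, var (s :: G) s
| VS : forall G s t, var G s -> var (t :: G) s.

Inductive tm : list ty -> ty -> Set :=
| Var : forall G s, var G s -> tm G s
| Lam : forall G s t, tm (s :: G) t -> tm G (s ~> t)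
| App : forall G s t, tm G (s ~> t) -> tm G s -> tm G t
| Zero : forall G, tm G Nat
| Succ : forall G, tm G (Nat ~> Nat)
| Rec : forall G s, tm G (s ~> (Nat ~> s ~> s) ~> Nat ~> s).

Arguments VZ {G s}.
Arguments VS {G s t} _.
Arguments Var {G s} _.
Arguments Lam {G s t} _.
Arguments App {G s t} _ _.
Arguments Zero {G}.
Arguments Succ {G}.
Arguments Rec {G} s.

Fixpoint env (G : list ty) : Set :=
  match G with
  | [] => unit
  | s :: G => (obj s * env G)%type
  end.

Fixpoint lookup {G s} (x : var G s) : env G -> obj s :=
  match x in var G s return env G -> obj s with
  | VZ _ _ => fun e => fst e
  | VS _ _ _ y => fun e => lookup y (snd e)
  end.

Fixpoint eval {G s} (u : tm G s) : env G -> obj s :=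
  match u in tm G s return env G -> obj s with
  | Var _ _ x => fun e => lookup x e
  | Lam _ _ _ b => fun e => fun a => eval b (a, e)
  | App _ _ _ f a => fun e => (eval f e) (eval a e)
  | Zero _ => fun _ => O
  | Succ _ => fun _ => S
  | Rec _ s => fun _ => fun a f n => nat_rect (fun _ => obj s) a f n
  end.

Definition closed_tm (s : ty) : Set := tm [] s.

Definition value {s} (u : closed_tm s) : obj s := eval u tt.

Definition is_exists3 (E : obj (pure 3)) : Prop :=
  (forall Y : obj (pure 2), (E Y <= 1)%nat) /\
  (forall Y : obj (pure 2),
     (exists f : obj (pure 1), Y f = O) <-> E Y = O).

Lemma exists3_unique_existence : exists! E, is_exists3 E.
Proof.
exists (fun Y => if excluded_middle_informative (exists f, Y f = O)
                 then O else 1%nat).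
split.
- split; intros Y; destruct (excluded_middle_informative _) as [H|H].
  + lia.
  + lia.
  + tauto.
  + split; [tauto | discriminate].
- intros E [E1 E2]; apply functional_extensionality; intros Y.
  destruct (excluded_middle_informative _) as [H|H].
  + symmetry; apply E2, H.
  + specialize (E1 Y).
    assert (E Y <> O) by (intros K; apply H, E2, K).
    lia.
Qed.

(** Kohlenbach's coding of rationals: the pair [(a, b)] stands for
    [(a/2) / (b+1)] if [a] is even and for [- ((a+1)/2) / (b+1)] if [a] is odd;
    pairs of naturals are coded by Cantor pairing. *)
Definition rat_of_code (c : nat) : Q :=
  let (a, b) := Cantor.of_nat c in
  Qmake (if Nat.even a then Z.of_nat (Nat.div2 a)
         else (- Z.of_nat (Nat.div2 (S a)))%Z)
        (Pos.of_succ_nat b).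

Lemma rat_of_code_surjective (q : Q) : exists c, rat_of_code c = q.
Proof.
destruct q as [z p].
exists (Cantor.to_nat
  (if (0 <=? z)%Z then 2 * Z.to_nat z else 2 * Z.to_nat (- z) - 1,
   Nat.pred (Pos.to_nat p))%nat).
unfold rat_of_code; rewrite Cantor.cancel_of_to; f_equal.
- destruct (Z.leb_spec 0 z) as [H|H].
  + rewrite Nat.even_mul, Nat.div2_double; simpl; lia.
  + set (k := Nat.pred (Z.to_nat (- z))).
    replace (2 * Z.to_nat (- z) - 1)%nat with (S (2 * k)) by (unfold k; lia).
    rewrite Nat.even_succ, Nat.odd_mul; simpl andb; cbv iota.
    replace (S (S (2 * k))) with (2 * S k)%nat by lia.
    rewrite Nat.div2_double; unfold k; lia.
- pose proof (Pos2Nat.is_pos p); apply Pos2Nat.inj.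
  rewrite SuccNat2Pos.id_succ; lia.
Qed.

Definition approx (x : obj (pure 1)) (n : nat) : Q := rat_of_code (x n).

Definition is_real (x : obj (pure 1)) : Prop :=
  forall n i : nat,
    (Qabs (approx x n - approx x (n + i)) < 2 ^ (- Z.of_nat n))%Q.

Definition real_eq (x y : obj (pure 1)) : Prop :=
  forall n : nat, (Qabs (approx x n - approx y n) <= 2 ^ (1 - Z.of_nat n))%Q.

(** The real number represented by [x]; meaningful only when [is_real x]. *)
Definition real_of (x : obj (pure 1)) : R :=
  real (Lim_seq (fun n => Q2R (approx x n))).

Local Open Scope R_scope.

Lemma Q2R_Qabs (q : Q) : Q2R (Qabs q) = Rabs (Q2R q).
Proof.
apply Qabs_case; intros H; apply Qle_Rle in H; rewrite RMicromega.Q2R_0 in H.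
- rewrite Rabs_right; lra.
- rewrite Q2R_opp, Rabs_left1; lra.
Qed.

Lemma Q2R_pow2 (z : Z) : Q2R (2 ^ z) = powerRZ 2 z.
Proof.
rewrite RMicromega.Q2RpowerRZ by (left; discriminate).
f_equal; unfold Q2R; simpl; lra.
Qed.

Lemma powerRZ_neg_nat (n : nat) : powerRZ 2 (- Z.of_nat n) = (/ 2) ^ n.
Proof. now rewrite powerRZ_neg', <- pow_powerRZ, pow_inv. Qed.

Lemma half_pow_lim (c : R) : is_lim_seq (fun n => c * (/ 2) ^ n) 0.
Proof.
replace 0 with (c * 0) by ring.
apply (is_lim_seq_scal_l _ c 0), is_lim_seq_geom.
rewrite Rabs_right; lra.
Qed.

Lemma is_real_R (x : obj (pure 1)) (n i : nat) : is_real x ->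
  Rabs (Q2R (approx x n) - Q2R (approx x (n + i))) < (/ 2) ^ n.
Proof.
intros H; specialize (H n i); apply Qlt_Rlt in H.
now rewrite Q2R_Qabs, Q2R_minus, Q2R_pow2, powerRZ_neg_nat in H.
Qed.

Lemma real_of_lim (x : obj (pure 1)) : is_real x ->
  is_lim_seq (fun n => Q2R (approx x n)) (real_of x).
Proof.
intros H; apply Lim_seq_correct', ex_lim_seq_cauchy_corr.
intros eps.
destruct (proj2 (is_lim_seq_spec _ _) (half_pow_lim 2) eps) as [N HN].
specialize (HN N (Nat.le_refl N)); cbv beta in HN.
rewrite Rminus_0_r in HN; apply Rabs_def2 in HN.
exists N; intros n m Hn Hm.
pose proof (is_real_R N (n - N) H) as A.
pose proof (is_real_R N (m - N) H) as B.
replace (N + (n - N))%nat with n in A by lia.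
replace (N + (m - N))%nat with m in B by lia.
apply Rabs_def2 in A; apply Rabs_def2 in B; apply Rabs_def1; lra.
Qed.

Lemma real_of_approx (x : obj (pure 1)) (n : nat) : is_real x ->
  Rabs (Q2R (approx x n) - real_of x) <= (/ 2) ^ n.
Proof.
intros H.
assert (L : is_lim_seq (fun i => Rabs (Q2R (approx x n) - Q2R (approx x (i + n))))
              (Rabs (Q2R (approx x n) - real_of x))).
{ apply (is_lim_seq_abs _ (Finite _)).
  apply (is_lim_seq_minus' (fun _ => Q2R (approx x n))); [apply is_lim_seq_const|].
  apply (is_lim_seq_incr_n (fun i => Q2R (approx x i)) n), real_of_lim, H. }
refine (is_lim_seq_le _ (fun _ => (/ 2) ^ n) _ _ _ L (is_lim_seq_const _)).
intros i; rewrite Nat.add_comm; apply Rlt_le, is_real_R, H.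
Qed.

Lemma real_eq_real_of (x y : obj (pure 1)) : is_real x -> is_real y ->
  (real_eq x y <-> real_of x = real_of y).
Proof.
intros Hx Hy.
assert (P : forall n, Q2R (2 ^ (1 - Z.of_nat n)) = 2 * (/ 2) ^ n).
{ intros n; rewrite Q2R_pow2; unfold Z.sub.
  rewrite powerRZ_add, powerRZ_neg_nat by lra; simpl; ring. }
split.
- intros H.
  assert (A : Rbar_le (Rabs (real_of x - real_of y)) 0).
  { refine (is_lim_seq_le
      (fun n => Rabs (Q2R (approx x n) - Q2R (approx y n))) _ _ _ _ _
      (half_pow_lim 2)).
    - intros n; specialize (H n); apply Qle_Rle in H.
      now rewrite Q2R_Qabs, Q2R_minus, P in H.
    - apply (is_lim_seq_abs _ (Finite _)), is_lim_seq_minus';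
        apply real_of_lim; assumption. }
  simpl in A.
  pose proof (Rabs_pos (real_of x - real_of y)).
  destruct (Req_dec (real_of x - real_of y) 0) as [E|E]; [lra|].
  apply Rabs_pos_lt in E; lra.
- intros E n; apply Rle_Qle.
  rewrite Q2R_Qabs, Q2R_minus, P.
  pose proof (real_of_approx n Hx) as A; pose proof (real_of_approx n Hy) as B.
  rewrite E in A; apply Rabs_le_between in A; apply Rabs_le_between in B.
  apply Rabs_le_between; lra.
Qed.

Definition is_char (D : obj (pure 2)) : Prop := forall f, (D f <= 1)%nat.

Definition mem (D : obj (pure 2)) (f : obj (pure 1)) : Prop := D f = 1%nat.

Definition is_char_rel (D : obj (pure 2))
    (prec : obj (pure 1 ~> pure 1 ~> Nat)) : Prop :=
  forall a b, mem D a -> mem D b -> (prec a b <= 1)%nat.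

Definition preceq (prec : obj (pure 1 ~> pure 1 ~> Nat))
    (a b : obj (pure 1)) : Prop := prec a b = 1%nat.

Definition directed (D : obj (pure 2))
    (prec : obj (pure 1 ~> pure 1 ~> Nat)) : Prop :=
  (exists a, mem D a) /\
  (forall a, mem D a -> preceq prec a a) /\
  (forall a b c, mem D a -> mem D b -> mem D c ->
     preceq prec a b -> preceq prec b c -> preceq prec a c) /\
  (forall a b, mem D a -> mem D b ->
     exists c, mem D c /\ preceq prec a c /\ preceq prec b c).

Definition net_in_unit_interval (D : obj (pure 2))
    (prec : obj (pure 1 ~> pure 1 ~> Nat)) (x : obj (pure 1 ~> pure 1)) : Prop :=
  directed D prec /\ forall d, mem D d -> is_real (x d) /\ 0 <= real_of (x d) <= 1.

Definition increasing (D : obj (pure 2))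
    (prec : obj (pure 1 ~> pure 1 ~> Nat)) (x : obj (pure 1 ~> pure 1)) : Prop :=
  forall a b, mem D a -> mem D b -> preceq prec a b -> real_of (x a) <= real_of (x b).

Definition net_converges_to (D : obj (pure 2))
    (prec : obj (pure 1 ~> pure 1 ~> Nat)) (x : obj (pure 1 ~> pure 1))
    (l : obj (pure 1)) : Prop :=
  forall eps : R, 0 < eps ->
    exists d0, mem D d0 /\
      forall e, mem D e -> preceq prec d0 e -> Rabs (real_of (x e) - real_of l) < eps.

(** The product type of the triple [(D, prec, x)] is curried. *)
Definition mct_ty : ty :=
  pure 2 ~> (pure 1 ~> pure 1 ~> Nat) ~> (pure 1 ~> pure 1) ~> pure 1.

Definition is_mct_realiser (Phi : obj mct_ty) : Prop :=
  forall (D : obj (pure 2)) (prec : obj (pure 1 ~> pure 1 ~> Nat))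
    (x : obj (pure 1 ~> pure 1)),
    is_char D -> is_char_rel D prec ->
    net_in_unit_interval D prec x -> increasing D prec x ->
    is_real (Phi D prec x) /\ net_converges_to D prec x (Phi D prec x).

(* Main.v *)
From Stdlib Require Import Reals Lra Lia List ZArith Qreals Classical.
From Coquelicot Require Import Coquelicot.
Require Import Defs.
Import ListNotations.

Set Implicit Arguments.

(** Both functionals are explicit.  Given [Y], preorder all of Baire space by
    "if [Y f = 0] then [Y g = 0]": this is a total preorder, hence directed, and
    the net that is [1] at the zeros of [Y] and [0] elsewhere is increasing with
    limit [1] or [0] according to whether [Y] has a zero, so that one rational
    approximation of the limit decides the existence of a zero.  Conversely, the
    limit of an increasing net is its supremum, and [exists^3] finds the largest
    [k <= 2^(n+3)] such that the [(n+3)]-th approximation of some member of the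
    net is at least [k / 2^(n+3)]; this fraction is within [2^-(n+2)] of the
    supremum. *)

Local Notation "f @@ a" := (App f a) (at level 40, left associativity).
Local Notation v0 := (Var VZ).
Local Notation v1 := (Var (VS VZ)).
Local Notation v2 := (Var (VS (VS VZ))).
Local Notation v3 := (Var (VS (VS (VS VZ)))).
Local Notation v5 := (Var (VS (VS (VS (VS (VS VZ)))))).

Local Ltac ev := cbn [eval lookup fst snd].

Local Open Scope nat_scope.

(** * Arithmetic in Gödel's T *)

Fixpoint num {G} (n : nat) : tm G Nat :=
  match n with
  | O => Zero
  | S m => Succ @@ num m
  end.

Lemma eval_num G (e : env G) n : eval (num n) e = n.
Proof. induction n; simpl; congruence. Qed.

Definition t_cond {G} : tm G (Nat ~> Nat ~> Nat ~> Nat) :=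
  Lam (Lam (Lam (Rec Nat @@ v1 @@ Lam (Lam v2) @@ v2))).

Lemma eval_cond G (e : env G) n a b :
  eval t_cond e n a b = match n with O => a | S _ => b end.
Proof. now destruct n. Qed.

Definition t_add {G} : tm G (Nat ~> Nat ~> Nat) :=
  Lam (Lam (Rec Nat @@ v0 @@ Lam Succ @@ v1)).

Lemma eval_add G (e : env G) m n : eval t_add e m n = m + n.
Proof. unfold t_add; ev; induction m; [easy|]; exact (f_equal S IHm). Qed.

Definition t_mul {G} : tm G (Nat ~> Nat ~> Nat) :=
  Lam (Lam (Rec Nat @@ Zero @@ Lam (Lam (t_add @@ v2 @@ v0)) @@ v1)).

Lemma eval_mul G (e : env G) m n : eval t_mul e m n = m * n.
Proof.
unfold t_mul; ev; induction m; [easy|].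
cbn [nat_rect]; rewrite eval_add; exact (f_equal (Nat.add n) IHm).
Qed.

Definition t_pred {G} : tm G (Nat ~> Nat) :=
  Lam (Rec Nat @@ Zero @@ Lam (Lam v1) @@ v0).

Lemma eval_pred G (e : env G) n : eval t_pred e n = pred n.
Proof. now destruct n. Qed.

Definition t_sub {G} : tm G (Nat ~> Nat ~> Nat) :=
  Lam (Lam (Rec Nat @@ v1 @@ Lam (Lam (t_pred @@ v0)) @@ v0)).

Lemma eval_sub G (e : env G) m n : eval t_sub e m n = m - n.
Proof.
unfold t_sub; ev; induction n; cbn [nat_rect obj] in *; [lia|].
rewrite eval_pred; exact (eq_trans (f_equal pred IHn) (eq_sym (Nat.sub_succ_r m n))).
Qed.

Definition t_odd {G} : tm G (Nat ~> Nat) :=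
  Lam (Rec Nat @@ Zero @@ Lam (Lam (t_sub @@ num 1 @@ v0)) @@ v0).

Lemma eval_odd G (e : env G) n : eval t_odd e n = Nat.b2n (Nat.odd n).
Proof.
unfold t_odd; ev; induction n; [easy|].
cbn [nat_rect]; rewrite eval_sub, eval_num, Nat.odd_succ, <- Nat.negb_odd.
etransitivity; [exact (f_equal (Nat.sub 1) IHn)|]; now destruct (Nat.odd n).
Qed.

Definition t_pair {G} : tm G (Nat ~> Nat ~> Nat) :=
  Lam (Lam (t_add @@ v0 @@
    (Rec Nat @@ Zero @@ Lam (Lam (t_add @@ (Succ @@ v1) @@ v0))
       @@ (t_add @@ v0 @@ v1)))).

Lemma eval_pair G (e : env G) a b : eval t_pair e a b = Cantor.to_nat (a, b).
Proof.
unfold t_pair, Cantor.to_nat; ev; rewrite !eval_add; f_equal.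
induction (b + a) as [|n IH]; [easy|].
cbn [nat_rect nat_rec]; rewrite eval_add; exact (f_equal (Nat.add (S n)) IH).
Qed.

(** A pair of naturals is represented by a function taking the components as
    values at [0] and at [1], since T has no product types. *)
Definition t_unpair {G} : tm G (Nat ~> Nat ~> Nat) :=
  Rec (Nat ~> Nat) @@ Lam Zero @@
    Lam (Lam (Lam (t_cond @@ v0
      @@ (t_cond @@ (v1 @@ num 0) @@ (Succ @@ (v1 @@ num 1))
            @@ (t_pred @@ (v1 @@ num 0)))
      @@ (t_cond @@ (v1 @@ num 0) @@ num 0 @@ (Succ @@ (v1 @@ num 1)))))).

Lemma eval_unpair G (e : env G) c :
  Cantor.of_nat c = (eval t_unpair e c 0, eval t_unpair e c 1).
Proof.
unfold t_unpair; ev; induction c as [|c IH]; [easy|].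
cbn [nat_rect Cantor.of_nat nat_rec]; fold (Cantor.of_nat c).
rewrite IH, !eval_cond, !eval_num, eval_pred.
match goal with |- context [match ?x with _ => _ end] => now destruct x end.
Qed.

(** For [k > 0] the value is [0] iff the rational with code [c] is at least
    [k / (N+1)]. *)
Definition t_ge {G} : tm G (Nat ~> Nat ~> Nat ~> Nat) :=
  Lam (Lam (Lam (t_add
    @@ (t_odd @@ (t_unpair @@ v2 @@ num 0))
    @@ (t_sub @@ (t_mul @@ (t_mul @@ num 2 @@ v1)
                        @@ (Succ @@ (t_unpair @@ v2 @@ num 1)))
              @@ (t_mul @@ (t_unpair @@ v2 @@ num 0) @@ (Succ @@ v0)))))).

Lemma eval_ge G (e : env G) c k N (Hk : 0 < k) :
  eval t_ge e c k N = 0 <->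
  (Z.of_nat k # Pos.of_succ_nat N <= rat_of_code c)%Q.
Proof.
unfold t_ge, rat_of_code; ev.
rewrite eval_add, eval_odd, eval_sub, !eval_mul, !eval_num.
rewrite (eval_unpair (Nat :: Nat :: Nat :: G) (N, (k, (c, e))) c).
set (a := eval t_unpair _ c 0); set (b := eval t_unpair _ c 1).
unfold Qle; cbn [Qnum Qden]; rewrite <- Nat.negb_odd.
change (Z.pos (Pos.of_succ_nat N)) with (Z.of_nat (S N)).
change (Z.pos (Pos.of_succ_nat b)) with (Z.of_nat (S b)).
clearbody a b.
pose proof (Nat.div2_odd a) as Ha.
destruct (Nat.odd a); cbn [negb Nat.b2n] in *.
- generalize (Nat.div2 (S a)); intros h; split; intros H; [lia|].
  assert (0 < Z.of_nat k * Z.of_nat (S b))%Z by (apply Z.mul_pos_pos; lia).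
  assert (0 <= Z.of_nat h * Z.of_nat (S N))%Z by (apply Z.mul_nonneg_nonneg; lia).
  lia.
- generalize dependent (Nat.div2 a); intros h ->.
  rewrite <- !Nat2Z.inj_mul, <- Nat2Z.inj_le; lia.
Qed.

Definition t_max {G} : tm G ((Nat ~> Nat) ~> Nat ~> Nat) :=
  Lam (Lam (Rec Nat @@ Zero
    @@ Lam (Lam (t_cond @@ (v3 @@ (Succ @@ v1)) @@ (Succ @@ v1) @@ v0)) @@ v0)).

Lemma eval_max G (e : env G) (P : nat -> nat) N :
  eval t_max e P N <= N /\
  (0 < eval t_max e P N -> P (eval t_max e P N) = 0) /\
  (forall j, eval t_max e P N < j <= N -> P j <> 0).
Proof.
unfold t_max; ev; induction N as [|N [IH1 [IH2 IH3]]].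
- simpl; repeat split; intros; lia.
- cbn [nat_rect]; rewrite eval_cond.
  destruct (P (S N)) eqn:HN.
  + repeat split; intros; [lia|assumption|lia].
  + repeat split; [apply le_S, IH1|assumption|].
    intros j [Hj1 Hj2].
    destruct (Nat.eq_dec j (S N)) as [->|]; [lia|].
    apply IH3; split; [exact Hj1|lia].
Qed.

Definition t_den {G} : tm G (Nat ~> Nat) :=
  Lam (Rec Nat @@ num 7 @@ Lam (Lam (t_add @@ v0 @@ (Succ @@ v0))) @@ v0).

Lemma eval_den G (e : env G) n : eval t_den e n = 2 ^ (n + 3) - 1.
Proof.
unfold t_den; ev; induction n; [easy|].
cbn [nat_rect]; rewrite eval_add.
etransitivity; [exact (f_equal (fun m => m + S m) IHn)|]; cbv beta.
pose proof (Nat.pow_nonzero 2 (n + 3) ltac:(lia)); simpl; lia.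
Qed.

(** * Representations of reals *)

Local Open Scope R_scope.

Lemma Q2R_frac z n : Q2R (z # Pos.of_succ_nat n) = IZR z / INR (S n).
Proof.
unfold Q2R; cbn [Qnum Qden].
change (Z.pos (Pos.of_succ_nat n)) with (Z.of_nat (S n)).
now rewrite <- INR_IZR_INZ.
Qed.

Lemma rat_of_code_frac k n :
  Q2R (rat_of_code (Cantor.to_nat (2 * k, n)%nat)) = INR k / INR (S n).
Proof.
unfold rat_of_code; rewrite Cantor.cancel_of_to.
rewrite Nat.even_mul, Nat.div2_double; cbn [Nat.even orb].
now rewrite Q2R_frac, <- INR_IZR_INZ.
Qed.

Lemma real_of_rate (x : obj (pure 1)) (l : R) :
  (forall n, Rabs (Q2R (approx x n) - l) <= / 4 * (/ 2) ^ n) ->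
  is_real x /\ real_of x = l.
Proof.
intros H; split.
- intros n i; apply Rlt_Qlt.
  rewrite Q2R_Qabs, Q2R_minus, Q2R_pow2, powerRZ_neg_nat.
  pose proof (H n) as A; pose proof (H (n + i)%nat) as B.
  rewrite pow_add in B.
  assert (P : 0 < (/ 2) ^ n) by (apply pow_lt; lra).
  assert (Q : (/ 2) ^ i <= 1).
  { rewrite <- (pow1 i); apply pow_incr; lra. }
  assert ((/ 2) ^ n * (/ 2) ^ i <= (/ 2) ^ n) by nra.
  apply Rabs_le_between in A; apply Rabs_le_between in B.
  apply Rabs_def1; lra.
- unfold real_of; rewrite (is_lim_seq_unique _ (Finite l)); [easy|].
  apply is_lim_seq_le_le with
    (u := fun n => l - / 4 * (/ 2) ^ n) (w := fun n => l + / 4 * (/ 2) ^ n).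
  + intros n; specialize (H n); apply Rabs_le_between in H; lra.
  + replace (Finite l) with (Finite (l - 0)) by (f_equal; ring).
    apply is_lim_seq_minus'; [apply is_lim_seq_const|apply half_pow_lim].
  + replace (Finite l) with (Finite (l + 0)) by (f_equal; ring).
    apply is_lim_seq_plus'; [apply is_lim_seq_const|apply half_pow_lim].
Qed.

Lemma real_of_const c :
  is_real (fun _ => c) /\ real_of (fun _ => c) = Q2R (rat_of_code c).
Proof.
apply real_of_rate; intros n; unfold approx.
rewrite Rminus_diag, Rabs_R0.
assert (0 < (/ 2) ^ n) by (apply pow_lt; lra); lra.
Qed.

(** * From the limit of a net to the existence of zeros *)

Definition t_exists3 : closed_tm (mct_ty ~> pure 3) :=
  Lam (Lam (t_cond
    @@ (t_ge
        @@ (v1 @@ Lam (num 1)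
               @@ Lam (Lam (t_cond @@ (v2 @@ v1)
                    @@ (t_cond @@ (v2 @@ v0) @@ num 1 @@ num 0) @@ num 1))
               @@ Lam (Lam (t_cond @@ (v2 @@ v1)
                    @@ (t_pair @@ num 2 @@ num 0) @@ (t_pair @@ num 0 @@ num 0)))
               @@ num 2)
        @@ num 1 @@ num 1)
    @@ num 0 @@ num 1)).

Lemma t_exists3_correct (Phi : obj mct_ty) :
  is_mct_realiser Phi -> is_exists3 (value t_exists3 Phi).
Proof.
intros HPhi.
enough (K : forall Y : obj (pure 2), (value t_exists3 Phi Y <= 1)%nat /\
          ((exists f, Y f = O) <-> value t_exists3 Phi Y = O)).
{ split; intros Y; apply K. }
intros Y; unfold value, t_exists3; ev; rewrite eval_cond, !eval_num.
set (D := fun _ : nat -> nat => 1%nat).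
match goal with |- context [Phi ?D' ?p ?x] =>
  set (prec := p); set (net := x); change D' with D end.
assert (Hprec : forall a b, prec a b = 1%nat <-> (Y a = O -> Y b = O)).
{ intros a b; unfold prec; rewrite !eval_cond, !eval_num.
  destruct (Y a), (Y b); intuition discriminate. }
assert (Hnet : forall d, is_real (net d) /\
          real_of (net d) = match Y d with O => 1 | S _ => 0 end).
{ intros d.
  assert (E : net d = fun _ => Cantor.to_nat
                (2 * match Y d with O => 1 | S _ => 0 end, 0)%nat).
  { unfold net; destruct (Y d); reflexivity. }
  rewrite E; destruct (real_of_const (Cantor.to_nat
    (2 * match Y d with O => 1 | S _ => 0 end, 0)%nat)) as [R1 R2].
  split; [exact R1|].
  rewrite R2, rat_of_code_frac; destruct (Y d); simpl; lra. }
destruct (HPhi D prec net) as [Hl Hlim].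
- intros f; apply Nat.le_refl.
- intros a b _ _; unfold prec; rewrite !eval_cond, !eval_num.
  destruct (Y a), (Y b); lia.
- split.
  + split; [exists (fun _ => O); reflexivity|].
    split; [intros a _; apply Hprec; tauto|].
    split; [intros a b c _ _ _; unfold preceq; rewrite !Hprec; tauto|].
    intros a b _ _; unfold preceq.
    destruct (Nat.eq_dec (Y a) 0) as [Ha|Ha].
    * exists a; rewrite !Hprec; split; [reflexivity|tauto].
    * exists b; rewrite !Hprec; split; [reflexivity|tauto].
  + intros d _; destruct (Hnet d) as [N1 N2]; split; [exact N1|].
    rewrite N2; destruct (Y d); lra.
- intros a b _ _ Hab; unfold preceq in Hab; rewrite Hprec in Hab.
  rewrite !(proj2 (Hnet _)); destruct (Y a), (Y b); try lra.
  now specialize (Hab eq_refl).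
- set (l := Phi D prec net) in *.
  pose proof (real_of_approx 2 Hl) as Ha; apply Rabs_le_between in Ha.
  simpl in Ha.
  destruct (Hlim (/ 8)) as [d0 [_ Hd0]]; [lra|].
  assert (Hq : forall G (e : env G),
    eval t_ge e (l 2%nat) 1%nat 1%nat = O <-> / 2 <= Q2R (approx l 2)).
  { intros G e; rewrite eval_ge by exact Nat.lt_0_1.
    unfold approx; split; intros H.
    - apply Qle_Rle in H; rewrite Q2R_frac in H; simpl in H; lra.
    - apply Rle_Qle; rewrite Q2R_frac; simpl; lra. }
  assert (Hex : (exists f, Y f = O) <-> / 2 <= Q2R (approx l 2)).
  { split.
    - intros [f Hf]; specialize (Hd0 f eq_refl).
      rewrite (proj2 (Hnet f)), Hf in Hd0.
      specialize (Hd0 (proj2 (Hprec _ _) (fun _ => Hf))).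
      apply Rabs_def2 in Hd0; lra.
    - intros H; exists d0.
      specialize (Hd0 d0 eq_refl (proj2 (Hprec _ _) (fun h => h))).
      rewrite (proj2 (Hnet d0)) in Hd0.
      destruct (Y d0); [reflexivity|].
      apply Rabs_def2 in Hd0; lra. }
  rewrite Hex, <- (Hq [pure 2; mct_ty] (Y, (Phi, tt))).
  destruct (eval t_ge _ _ _ _); split; intuition lia.
Qed.

(** * From the existence of zeros to the limit of a net *)

Lemma increasing_net_converges D prec x (l : obj (pure 1)) :
  increasing D prec x ->
  is_lub (fun r => exists d, mem D d /\ r = real_of (x d)) (real_of l) ->
  net_converges_to D prec x l.
Proof.
intros Hinc [Hub Hleast] eps Heps.
destruct (classic
  (exists d0, mem D d0 /\ real_of l - eps < real_of (x d0))) as [[d0 [H0 H1]]|H].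
- exists d0; split; [exact H0|]; intros e He Hle.
  specialize (Hinc d0 e H0 He Hle).
  assert (real_of (x e) <= real_of l) by (apply Hub; eauto).
  apply Rabs_def1; lra.
- enough (real_of l <= real_of l - eps) by lra.
  apply Hleast; intros r [d [Hd ->]].
  apply Rnot_lt_le; intros K; apply H; eauto.
Qed.

Definition t_mct : closed_tm (pure 3 ~> mct_ty) :=
  Lam (Lam (Lam (Lam (Lam
    (t_pair @@ (t_mul @@ num 2 @@
       (t_max @@ Lam (v5 @@ Lam (t_cond @@ (v5 @@ v0) @@ num 1
                    @@ (t_ge @@ (v3 @@ v0 @@ (t_add @@ v2 @@ num 3))
                             @@ v1 @@ (t_den @@ v2))))
          @@ (Succ @@ (t_den @@ v0))))
       @@ (t_den @@ v0)))))).

(** Without this, the kernel compares [value t_mct] with its unfolding by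
    normalising the arithmetic subterms, which does not end in reasonable time. *)
Local Strategy 1000 [num t_cond t_add t_mul t_pair t_ge t_max t_den].

Lemma t_mct_correct (E : obj (pure 3)) :
  is_exists3 E -> is_mct_realiser (value t_mct E).
Proof.
intros [_ HE] D prec x HD _ [Hdir Hx] Hinc.
assert (Hlub : exists L, is_lub (fun r => exists d, mem D d /\ r = real_of (x d)) L).
{ destruct (completeness (fun r => exists d, mem D d /\ r = real_of (x d)))
    as [L HL]; [| |eauto].
  - exists 1; intros r [d [Hd ->]]; apply Hx, Hd.
  - destruct Hdir as [[a Ha] _]; eauto. }
destruct Hlub as [L HL].
enough (K : is_real (value t_mct E D prec x) /\ real_of (value t_mct E D prec x) = L).
{ destruct K as [K1 K2]; split; [exact K1|].
  apply increasing_net_converges; [assumption..|now rewrite K2]. }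
apply real_of_rate; intros n; unfold approx, value, t_mct; ev.
rewrite eval_pair, eval_mul, eval_num, rat_of_code_frac.
match goal with |- context [@eval ?G0 _ t_max ?e0 ?P0 ?N0] =>
  set (P := P0); generalize (eval_max G0 e0 P N0);
  generalize (@eval G0 _ t_max e0 P N0) end.
rewrite !eval_den; intros k [H1 [H2 H3]].
set (N := (2 ^ (n + 3) - 1)%nat) in *.
assert (HP : forall j, (0 < j)%nat ->
  (P j = O <-> exists d, mem D d /\ INR j / INR (S N) <= Q2R (approx (x d) (n + 3)))).
{ intros j Hj; unfold P; rewrite <- HE.
  split; intros [d Hd]; exists d.
  - rewrite eval_cond, eval_add, eval_den, !eval_num in Hd.
    destruct (D d) as [|m] eqn:Hm; [discriminate|].
    split; [apply Nat.le_antisymm; [apply HD|rewrite Hm; apply le_n_S, Nat.le_0_l]|].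
    apply eval_ge, Qle_Rle in Hd; [|exact Hj].
    rewrite Q2R_frac, <- INR_IZR_INZ in Hd; exact Hd.
  - destruct Hd as [Hm Hd]; unfold mem in Hm.
    rewrite eval_cond, eval_add, eval_den, !eval_num, Hm.
    apply eval_ge; [exact Hj|].
    apply Rle_Qle; rewrite Q2R_frac, <- INR_IZR_INZ; exact Hd. }
clearbody P.
assert (HN : / INR (S N) = (/ 2) ^ (n + 3)).
{ pose proof (Nat.pow_nonzero 2 (n + 3) ltac:(lia)).
  unfold N; replace (S (2 ^ (n + 3) - 1)) with (2 ^ (n + 3))%nat by lia.
  now rewrite pow_INR, pow_inv. }
assert (HN0 : 0 < INR (S N)) by apply lt_0_INR, Nat.lt_0_succ.
destruct HL as [Hub Hleast].
assert (Hd : forall d, mem D d -> 0 <= real_of (x d) <= 1 /\ real_of (x d) <= L /\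
   Rabs (Q2R (approx (x d) (n + 3)) - real_of (x d)) <= / INR (S N)).
{ intros d Hd; repeat split; try apply Hx, Hd; [apply Hub; eauto|].
  rewrite HN; apply real_of_approx, Hx, Hd. }
assert (Hlow : INR k / INR (S N) - / INR (S N) <= L).
{ destruct (Nat.eq_dec k 0) as [->|Hk].
  - destruct Hdir as [[a Ha] _]; specialize (Hd a Ha).
    pose proof (Rinv_0_lt_compat _ HN0); simpl (INR 0); lra.
  - destruct (proj1 (HP k ltac:(lia)) (H2 ltac:(lia))) as [d [Hm Hq]].
    specialize (Hd d Hm); destruct Hd as [_ [Hd1 Hd2]].
    apply Rabs_le_between in Hd2; lra. }
assert (Hup : L <= INR k / INR (S N) + 2 * / INR (S N)).
{ apply Hleast; intros r [d [Hm ->]]; destruct (Hd d Hm) as [Hd0 [Hd1 Hd2]].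
  apply Rabs_le_between in Hd2.
  destruct (Nat.eq_dec k (S N)) as [->|Hk].
  - pose proof (Rinv_0_lt_compat _ HN0).
    unfold Rdiv; rewrite Rinv_r by lra; lra.
  - assert (~ INR (S k) / INR (S N) <= Q2R (approx (x d) (n + 3))).
    { intros K; apply (H3 (S k)); [lia|]; apply HP; [lia|eauto]. }
    rewrite (S_INR k) in *; unfold Rdiv in *; lra. }
replace (/ 4 * (/ 2) ^ n) with (2 * / INR (S N)).
- apply Rabs_le_between; pose proof (Rinv_0_lt_compat _ HN0); lra.
- rewrite HN, pow_add; simpl; lra.
Qed.

Theorem corollary3p7 :
  (exists t : closed_tm (mct_ty ~> pure 3),
     forall Phi : obj mct_ty, is_mct_realiser Phi -> is_exists3 (value t Phi)) /\
  (exists s : closed_tm (pure 3 ~> mct_ty),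
     forall E : obj (pure 3), is_exists3 E -> is_mct_realiser (value s E)).
Proof.
split.
- exists t_exists3; exact t_exists3_correct.
- exists t_mct; exact t_mct_correct.
Qed.
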